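(* Let $k$ be a positive integer, and let $G$ be a graph with minimum degree $\delta\ge 2k+2$. Suppose that \[ \lambda_2(G)<\delta-\frac{2\left(k+\frac{\delta-1}{\delta}\right)}{\delta+1}. \] Then $G$ has property $P(k,\delta)$.
   Context: All graphs are finite, undirected and simple. The eigenvalues of a graph $G$ are the eigenvalues of its adjacency matrix, and $\lambda_2(G)$ denotes the second largest one (counted with multiplicity). For a connected graph $G$, $\tau(G)$ is the maximum number of pairwise edge-disjoint spanning trees in $G$ (with $\tau(K_1)=\infty$), and $\tau(G)=0$ if $G$ is disconnected. For a nonnegative integer $k$ and a positive integer $d$, a graph $G$ has property $P(k,d)$ if: (a) $\tau(G)\ge k$; (b) apart from $k$ edge-disjoint spanning trees of $G$, there is another forest $F$ in $G$ (edge-disjoint from these $k$ spanning trees) with $|E(F)|>\frac{d-1}{d}(|V(G)|-1)$; and (c) if this $F$ is not a spanning tree of $G$, then $F$ has a component with at least $d$ edges. (That is, there exist $k$ pairwise edge-disjoint spanning trees and a forest $F$ edge-disjoint from all of them such that $F$ satisfies both the conditions in (b) and (c).) *)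

(* Defs.v *)
From HB Require Import structures.
From mathcomp Require Import all_boot all_order all_algebra.
From mathcomp Require Import polyrcf.

Set Implicit Arguments.
Unset Strict Implicit.
Unset Printing Implicit Defensive.

Import Order.TTheory GRing.Theory Num.Theory.
Local Open Scope ring_scope.

Record sgraph := SGraph {
  vertex :> finType;
  adj : rel vertex;
  adj_sym : symmetric adj;
  adj_irrefl : irreflexive adj
}.

Definition edges (G : sgraph) : {set {set G}} :=
  [set E : {set G} | [exists x, exists y, adj x y && (E == [set x; y])]].

Definition degree (G : sgraph) (x : G) : nat := #|[set y | adj x y]|.

(* Every degree is < #|G|, so the default value #|G| of the iterated minimum
   is never the result unless G has no vertex (and then the result is 0). *)
Definition min_degree (G : sgraph) : nat :=
  \big[minn/#|G|]_(x : G) degree x.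

Definition adjacency_mx (R : pzSemiRingType) (G : sgraph) : 'M[R]_#|G| :=
  \matrix_(i, j) (adj (enum_val i) (enum_val j))%:R.

(* rootsR lists the distinct roots in R in increasing order, so this is the
   nonincreasing list of the eigenvalues in R, with algebraic multiplicities.
   When A is symmetric, char_poly A splits over R and the list has length n. *)
Definition eigenvalues (R : rcfType) (n : nat) (A : 'M[R]_n) : seq R :=
  flatten [seq nseq (mup a (char_poly A)) a | a <- rev (rootsR (char_poly A))].

(* Entry number 1, counting from 0, of a nonincreasing list. *)
Definition lambda2 (R : rcfType) (G : sgraph) : R :=
  (eigenvalues (adjacency_mx R G))`_1.

(* A set of edges F stands for the subgraph with edge set F and with all the
   vertices of G; a forest of G that misses some vertices is thereby padded with
   isolated vertices, which changes neither its number of edges, nor its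
   components with at least one edge, nor whether it is a spanning tree. *)
Definition edge_rel (G : sgraph) (F : {set {set G}}) : rel G :=
  [rel x y | [set x; y] \in F].

Definition is_forest (G : sgraph) (F : {set {set G}}) : Prop :=
  F \subset edges G /\
  forall c : seq G, (2 < size c)%N -> ~ ucycle (edge_rel F) c.

Definition is_spanning_tree (G : sgraph) (F : {set {set G}}) : Prop :=
  is_forest F /\ forall x y : G, connect (edge_rel F) x y.

Definition component_edges (G : sgraph) (F : {set {set G}}) (x : G) :
    {set {set G}} :=
  [set E in F | E \subset [set y | connect (edge_rel F) x y]].

(* The empty edge set is disjoint from itself, so for a one-vertex graph such a
   family exists for every k, in accordance with tau(K_1) = oo. *)
Definition spanning_tree_packing (G : sgraph) (k : nat)
    (T : 'I_k -> {set {set G}}) : Prop :=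
  (forall i, is_spanning_tree (T i)) /\
  (forall i j, i != j -> [disjoint T i & T j]).

Definition propertyP (G : sgraph) (k d : nat) : Prop :=
  exists (T : 'I_k -> {set {set G}}) (F : {set {set G}}),
    [/\ spanning_tree_packing T,
        is_forest F /\ (forall i, [disjoint F & T i]),
        (d%:R - 1) / d%:R * (#|G|%:R - 1) < #|F|%:R :> rat
      & ~ is_spanning_tree F ->
          exists x : G, (d <= #|component_edges F x|)%N].

(* Main.v *)
Require Import Defs.
From mathcomp Require Import all_boot all_order all_algebra.
From mathcomp Require Import polyrcf complex ring lra zify.

(* Write d for the minimum degree, kappa = k + (d - 1) / d, and let t be the
   number of parts of a partition of the vertices into components of some edge
   set.

   Spectral part: if X and Y are disjoint, the restriction of A - lambda_2 to the
   span of their indicator vectors is not positive definite, which gives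
   e(X, Y)^2 >= (m |X| - e(X, X^c)) (m |Y| - e(Y, Y^c)) with m = d - lambda_2
   as soon as both factors are positive. A part cut by fewer than 2 kappa <= d
   edges has more than d vertices, so both factors exceed 2 kappa minus the cut.
   Comparing every part with the one of least cut yields at least
   kappa (t - 1) crossing edges.

   Combinatorial part: for a maximal packing of forests, let E be the set of the
   edges that can be left unused after a sequence of edge exchanges. Each forest,
   restricted to E, connects every component of E, and all the edges crossing
   these components are used; this bounds their number from above. With k forests
   the two bounds force k spanning trees. Adding a last forest F to them, either
   E is connected and F is a spanning tree, or F has c components with
   d c <= t - 1 + d. Then |V| >= t + d: otherwise all parts have at most d
   vertices, hence cut at least d >= 2 k + 2, too many for the upper bound.
   So F has enough edges, and as |V| > d c, not all its components have fewer than
   d edges. *)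

Set Implicit Arguments.
Unset Strict Implicit.
Unset Printing Implicit Defensive.

Import Order.TTheory GRing.Theory Num.Theory.

(** * Forests *)

Section Acyclic.
Variable G : sgraph.
Implicit Types (F E : {set {set G}}) (a b x y : G).

Lemma edge_rel_sym F : symmetric (edge_rel F).
Proof. by move=> x y; rewrite /edge_rel /= setUC. Qed.

Lemma edge_connect_sym F : connect_sym (edge_rel F).
Proof. exact/sym_connect_sym/edge_rel_sym. Qed.

Lemma edgesP (e : {set G}) :
  reflect (exists x y, adj x y /\ e = [set x; y]) (e \in edges G).
Proof.
rewrite inE; apply: (iffP existsP) => [[x /existsP[y /andP[xy /eqP->]]]|].
  by exists x, y.
by move=> [x [y [xy ->]]]; exists x; apply/existsP; exists y; rewrite xy /=.
Qed.

Lemma set2_eq (T : finType) (x y a b : T) :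
  [set x; y] = [set a; b] -> x = a /\ y = b \/ x = b /\ y = a.
Proof.
move=> eq.
have /pred2P xab : (x == a) || (x == b) by rewrite -in_set2 -eq set21.
have /pred2P yab : (y == a) || (y == b) by rewrite -in_set2 -eq set22.
have /pred2P axy : (a == x) || (a == y) by rewrite -in_set2 eq set21.
have /pred2P bxy : (b == x) || (b == y) by rewrite -in_set2 eq set22.
by intuition congruence.
Qed.

Lemma mem_edges x y : ([set x; y] \in edges G) = adj x y.
Proof.
apply/edgesP/idP => [[a [b [ab eq]]]|xy]; last by exists x, y.
by case: (set2_eq eq) ab => [[-> ->]|[-> ->]] //; rewrite adj_sym.
Qed.

Lemma connect_edge F x y : [set x; y] \in F -> connect (edge_rel F) x y.
Proof. by move=> xyF; apply: connect1. Qed.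

Lemma connect_mono E F : E \subset F ->
  subrel (connect (edge_rel E)) (connect (edge_rel F)).
Proof.
by move=> /subsetP EF; apply: connect_sub => x y xy; apply/connect1/EF.
Qed.

Lemma connect_setU1 F a b x y :
  connect (edge_rel ([set a; b] |: F)) x y ->
  [\/ connect (edge_rel F) x y,
      connect (edge_rel F) x a /\ connect (edge_rel F) b y |
      connect (edge_rel F) x b /\ connect (edge_rel F) a y].
Proof.
move=> /connectP[p pP ->]; elim: p x pP => [|z p IH] x /=.
  by move=> _; constructor 1; apply: connect0.
move=> /andP[+ /IH]; rewrite /edge_rel /= !inE => /orP[/eqP eq|xz].
  have: x = a /\ z = b \/ x = b /\ z = a.
    exact: set2_eq.
  move: (last z p) => w [[-> ->]|[-> ->]].
    by case=> [c|[c d]|[c d]]; [constructor 2|constructor 2|constructor 1]; rewrite ?connect0.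
  by case=> [c|[c d]|[c d]]; [constructor 3|constructor 1|constructor 3]; rewrite ?connect0.
have {}xz : connect (edge_rel F) x z by apply: connect1.
case=> [c|[c d]|[c d]]; [constructor 1|constructor 2|constructor 3].
- exact: connect_trans c.
- by split=> //; apply: connect_trans c.
- by split=> //; apply: connect_trans c.
Qed.

Lemma connect_setU1_same F a b : connect (edge_rel F) a b ->
  connect (edge_rel ([set a; b] |: F)) =2 connect (edge_rel F).
Proof.
move=> ab x y; apply/idP/idP; last exact/connect_mono/subsetU1.
case/connect_setU1 => [//|[xa b_y]|[xb a_y]].
  exact: connect_trans xa (connect_trans ab b_y).
by rewrite edge_connect_sym in ab; apply: connect_trans xb (connect_trans ab a_y).
Qed.

(* Every edge is a bridge; this also excludes loops, [connect] being reflexive. *)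
Definition acyclic F :=
  [forall x, forall y, ([set x; y] \in F) ==>
     ~~ connect (edge_rel (F :\ [set x; y])) x y].

Lemma acyclicP F :
  reflect (forall x y, [set x; y] \in F ->
             ~~ connect (edge_rel (F :\ [set x; y])) x y)
          (acyclic F).
Proof.
apply: (iffP forallP) => [H x y|H x]; first exact/implyP/(forallP (H x)).
by apply/forallP => y; apply/implyP/H.
Qed.

Lemma acyclic0 : acyclic set0.
Proof. by apply/acyclicP => x y; rewrite inE. Qed.

Lemma acyclic_sub E F : E \subset F -> acyclic F -> acyclic E.
Proof.
move=> EF /acyclicP aF; apply/acyclicP => x y xyE.
apply: contra (aF x y (subsetP EF _ xyE)); exact/connect_mono/setSD.
Qed.

(** If an old edge [[set x; y]] stopped being a bridge, the detour around it would use the new edge,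
    and the rest of that circuit would join [a] to [b] inside [F]. *)
Lemma acyclic_setU1 F a b :
  acyclic F -> ~~ connect (edge_rel F) a b -> acyclic ([set a; b] |: F).
Proof.
move=> aF nab; have abF : [set a; b] \notin F by apply: contra nab => /connect_edge.
apply/acyclicP => x y; rewrite in_setU1.
have [eq _|neq /= xyF] := eqVneq [set x; y] [set a; b].
  rewrite eq setU1K //; case: (set2_eq eq) => [[-> ->]|[-> ->]] //.
  by rewrite edge_connect_sym.
have -> : ([set a; b] |: F) :\ [set x; y] = [set a; b] |: (F :\ [set x; y]).
  by apply/setP => e; rewrite !inE; case: (eqVneq e [set a; b]) => // ->; rewrite eq_sym neq.
move/acyclicP: (aF) => /(_ _ _ xyF) nxy; apply/negP.
have FF : subrel (connect (edge_rel (F :\ [set x; y]))) (connect (edge_rel F)).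
  exact/connect_mono/subD1set.
have xy : connect (edge_rel F) x y by apply: connect_edge.
case/connect_setU1 => [xy'|[/FF xa /FF b_y]|[/FF xb /FF ay]]; first by rewrite xy' in nxy.
  rewrite edge_connect_sym in xa; rewrite edge_connect_sym in b_y.
  by move: (connect_trans xa (connect_trans xy b_y)); rewrite (negPf nab).
rewrite edge_connect_sym in xy.
by move: (connect_trans ay (connect_trans xy xb)); rewrite (negPf nab).
Qed.

(* A minimal [D] joining [a] and [b] is the path of the forest between them. *)
Lemma acyclic_path F a b :
  F \subset edges G -> acyclic F -> connect (edge_rel F) a b ->
  exists2 D : {set {set G}}, D \subset F /\ connect (edge_rel D) a b
    & forall e, e \in D -> ~~ connect (edge_rel (F :\ e)) a b.
Proof.
move=> FG /acyclicP aF ab.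
have [D /minsetP[Dab Dmin] DF] := @minset_exists _ (fun D => connect (edge_rel D) a b) F ab.
exists D => // e eD; have eF := subsetP DF _ eD.
case/edgesP: (subsetP FG _ eF) => x [y [_ def_e]].
have Ne : ~~ connect (edge_rel (D :\ e)) a b.
  by apply/negP => /Dmin/(_ (subD1set _ _)) /setP/(_ e); rewrite eD !inE eqxx.
move: Dab; rewrite -(setD1K eD) def_e -def_e.
have DFe : subrel (connect (edge_rel (D :\ e))) (connect (edge_rel (F :\ e))).
  exact/connect_mono/setSD.
rewrite [X in X |: _]def_e => /connect_setU1; rewrite def_e in eF.
have := aF _ _ eF; rewrite -def_e => nxy.
case=> [ab'|[/DFe ax /DFe yb]|[/DFe ay /DFe xb]]; first by rewrite ab' in Ne.
  apply: contra nxy => ab'; rewrite edge_connect_sym in ax.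
  rewrite edge_connect_sym in yb.
  exact: connect_trans ax (connect_trans ab' yb).
apply: contra nxy => ab'; rewrite edge_connect_sym in ab'.
exact: connect_trans xb (connect_trans ab' ay).
Qed.

(** * Counting components *)

Definition ncomp F := n_comp (edge_rel F) predT.

Lemma ncompE F : ncomp F = #|fingraph.roots (edge_rel F)|.
Proof. by apply: eq_card => x; rewrite !inE andbT. Qed.

Lemma ncomp0 : ncomp set0 = #|G|.
Proof.
rewrite ncompE; apply: eq_card => x; apply/eqP; apply/esym.
case/connectP: (connect_root (edge_rel set0) x) => -[|y p] /=; first by [].
by rewrite {1}/edge_rel /= in_set0.
Qed.

Lemma eq_ncomp E F : connect (edge_rel E) =2 connect (edge_rel F) -> ncomp E = ncomp F.
Proof. by move=> eq; apply: eq_n_comp. Qed.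

(** Split the vertices by the closure [C] of [a] and [b]: inside [C] the new edge merges two
    components into one, outside [C] the components and their roots do not change. *)
Lemma ncomp_setU1 F a b : ~~ connect (edge_rel F) a b ->
  ncomp F = (ncomp ([set a; b] |: F)).+1.
Proof.
move=> nab; set F' := _ |: F.
pose C := closure (edge_rel F) (pred2 a b).
have memC x : (x \in C) = connect (edge_rel F) x a || connect (edge_rel F) x b.
  apply/pred0Pn/orP => [[z /andP[xz]]|].
    by rewrite !inE => /orP[]/eqP <-; [left|right].
  by case=> xz; [exists a|exists b]; apply/andP; rewrite !inE eqxx ?orbT.
have abF' : connect (edge_rel F') a b by apply: connect_edge; apply: setU11.
have FF' : subrel (connect (edge_rel F)) (connect (edge_rel F')).
  exact/connect_mono/subsetU1.
rewrite /ncomp (n_compC C (edge_rel F)) (n_compC C (edge_rel F')).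
rewrite n_comp_closure2; last exact: edge_connect_sym.
have eqC : n_comp (edge_rel F') C = n_comp (edge_rel F') (connect (edge_rel F') a).
  apply: eq_n_comp_r => x; transitivity (connect (edge_rel F') x a); last first.
    exact: edge_connect_sym.
  rewrite memC; apply/orP/idP => [[/FF' xa|/FF' xb]|] //.
    by apply: connect_trans xb _; rewrite edge_connect_sym.
  by case/connect_setU1 => [|[]|[]]; tauto.
rewrite eqC n_comp_connect; last exact: edge_connect_sym.
rewrite nab addSn add1n; congr _.+2; apply: eq_card => x.
rewrite !inE /=; case xC: (x \in C) => //=; rewrite ?andbF // !andbT.
congr (_ == _); rewrite /fingraph.root; congr (odflt _ _); apply: eq_pick => y /=.
apply/idP/idP => [/FF' //|/connect_setU1].
by move: xC; rewrite memC => /norP[/negPf xa /negPf xb] [|[]|[]]; rewrite ?xa ?xb.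
Qed.

Lemma edge_ind (P : {set {set G}} -> Prop) :
  P set0 ->
  (forall F a b, [set a; b] \notin F -> [set a; b] \in edges G ->
     F \subset edges G -> P F -> P ([set a; b] |: F)) ->
  forall F, F \subset edges G -> P F.
Proof.
move=> P0 PS F; have [n] := ubnP #|F|; elim: n F => // n IH F.
have [-> //|[e eF]] := set_0Vmem F.
rewrite (cardsD1 e) eF ltnS => /IH{}IH FG.
have FeG := subset_trans (subD1set F e) FG; have eG := subsetP FG _ eF.
rewrite -(setD1K eF); case/edgesP: (eG) => a [b [_ def_e]].
by rewrite {1}def_e; apply: PS; rewrite -?def_e ?setD11 //; apply: IH.
Qed.

Lemma acyclic_card_ncomp F : F \subset edges G -> acyclic F -> #|F| + ncomp F = #|G|.
Proof.
elim/edge_ind => [|{}F a b abF _ _ IH aF]; first by rewrite ncomp0 cards0.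
rewrite cardsU1 abF add1n addSnnS -ncomp_setU1.
  by apply: IH; apply: acyclic_sub aF; apply: subsetU1.
by have /acyclicP/(_ a b (setU11 _ _)) := aF; rewrite setU1K.
Qed.

(** The remaining vertices of a cycle through [x] and [y] give a detour around the edge
    [[set x; y]], which is therefore not a bridge. *)
Lemma acyclic_is_forest F : F \subset edges G -> acyclic F -> is_forest F.
Proof.
move=> FG /acyclicP aF; split=> // -[|x [|y [|z c]]] // _ /andP[].
rewrite (cycle_path x) => /and4P[lx xy yz zc].
rewrite [uniq _]/= in_cons negb_or => /and3P[/andP[_ xc] yc _].
have notin u : u \in z :: c -> u \notin [:: x; y].
  by apply: contraL; rewrite !inE => /orP[]/eqP->.
have keep u v : edge_rel F u v -> (u \notin [:: x; y]) || (v \notin [:: x; y]) ->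
    edge_rel (F :\ [set x; y]) u v.
  move=> uv uvN; rewrite /edge_rel /= in_setD1; apply/andP; split=> //.
  by apply: contraL uvN => /eqP/set2_eq[[-> ->]|[-> ->]]; rewrite !inE !eqxx ?orbT.
have /negP := aF _ _ xy; apply; rewrite edge_connect_sym.
apply/connectP; exists (rcons (z :: c) x); last by rewrite last_rcons.
rewrite rcons_path; apply/andP; split; first (apply/andP; split).
- by apply: keep => //; rewrite (notin z) ?mem_head ?orbT.
- apply: (@sub_in_path _ [in z :: c] (edge_rel F)) zc; last exact: allss.
  by move=> u v /notin u_xy _ uv; apply: keep; rewrite ?u_xy.
- by apply: keep => //=; rewrite (notin (last z c)) ?mem_last.
Qed.

End Acyclic.

(** * Maximal packings of forests *)

Section Packing.
Variables (G : sgraph) (I : finType).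
Local Notation family := {ffun I -> {set {set G}}}.
Implicit Types (F : family) (D E H : {set {set G}}) (i : I).

Definition packing F :=
  [forall i, (F i \subset edges G) && acyclic (F i)] &&
  [forall i, forall j, (i != j) ==> [disjoint F i & F j]].

Lemma packingP F :
  reflect [/\ forall i, F i \subset edges G, forall i, acyclic (F i)
            & forall i j, i != j -> [disjoint F i & F j]]
          (packing F).
Proof.
apply: (iffP andP) => [[/forallP FP /forallP FD]|[FG aF FD]].
  split=> [i|i|i j]; try by case/andP: (FP i).
  exact/implyP/(forallP (FD i)).
split; apply/forallP => i; first by rewrite FG aF.
by apply/forallP => j; apply/implyP/FD.
Qed.

Definition unused F := edges G :\: \bigcup_i F i.

Lemma unusedP F e :
  reflect (e \in edges G /\ forall i, e \notin F i) (e \in unused F).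
Proof.
rewrite in_setD; apply: (iffP andP) => [[/bigcupP eF eG]|[eG eF]]; split=> //.
  by move=> i; apply/negP => ei; apply: eF; exists i.
by apply/bigcupP => -[i _]; apply/negP.
Qed.

Definition update F i H : family := [ffun j => if j == i then H else F j].

Lemma packing_update F i H : packing F -> H \subset edges G -> acyclic H ->
  (forall j, j != i -> [disjoint H & F j]) -> packing (update F i H).
Proof.
move=> /packingP[FG aF FD] HG aH HD; apply/packingP.
split=> [j|j|j l]; rewrite !ffunE; try by case: eqP.
case: (eqVneq j i) => [->|ji]; case: (eqVneq l i) => [eq|li] //.
- by move=> _; apply: HD.
- by rewrite disjoint_sym => _; apply: HD.
- exact: FD.
Qed.

Lemma packing_exchange F i e D : packing F -> e \in unused F -> D \subset F i ->
  acyclic (e |: D) -> packing (update F i (e |: D)).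
Proof.
move=> FP /unusedP[eG eF] DF aD; apply: packing_update => //.
  case/packingP: FP => FG _ _.
  by rewrite subUset sub1set eG (subset_trans DF (FG i)).
move=> j ji; rewrite disjoint_sym disjoints_subset; apply/subsetP => f fj.
rewrite !inE negb_or; apply/andP; split.
  by apply: contraTneq fj => ->; apply: eF.
case/packingP: FP => _ _ /(_ _ _ ji) /pred0P/(_ f) /=; rewrite fj /=.
by apply: contraFN => /(subsetP DF).
Qed.

Definition swap : rel family := fun F F' =>
  packing F' && [exists i, exists e, exists f,
    [&& e \in unused F, f \in F i & F' == update F i (e |: F i :\ f)]].

(** The forest that gains an edge is the one that loses one. As sizes are kept, the maximality of
    the first packing still constrains every packing reached from it. *)
Lemma swap_connect F F' : connect swap F F' -> packing F ->
  packing F' /\ forall i, #|F' i| = #|F i|.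
Proof.
case/connectP => p; elim: p F => [|F1 p IH] F /= => [_ -> //|].
case/andP => /andP[F1P /existsP[i /existsP[e /existsP[f /and3P[eF fF /eqP def]]]]].
move=> /IH{}IH /IH/(_ F1P)[F'P eq] FP; split=> // j; rewrite eq def ffunE.
case: eqP => // ->; case/unusedP: eF => _ /(_ i) eF.
by rewrite cardsU1 !inE (negPf eF) andbF /= (cardsD1 f (F i)) fF.
Qed.

Definition maximal_packing F := packing F /\
  forall F', packing F' -> (forall i, #|F i| <= #|F' i|) ->
    forall i, #|F' i| = #|F i|.

(** Maximize the total size among the packings whose sizes all dominate those of [F]; equal sums
    then force equal sizes. The lower bound on each size later keeps spanning trees spanning. *)
Lemma maximal_packing_exists F : packing F ->
  exists2 F', maximal_packing F' & forall i, #|F i| <= #|F' i|.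
Proof.
move=> FP; pose P F' := packing F' && [forall i, #|F i| <= #|F' i|].
have PF : P F by rewrite /P FP; apply/forallP.
case: (@arg_maxnP _ F P (fun F' => \sum_i #|F' i|) PF).
move=> F1 /andP[F1P /forallP le1] max1; exists F1 => //; split=> // F2 F2P le12.
have P2 : P F2 by rewrite /P F2P; apply/forallP => i; apply: leq_trans (le12 i).
have le21 : \sum_i #|F2 i| <= \sum_i #|F1 i| := max1 _ P2.
move=> i; apply/eqP; rewrite eq_sym; move: i; apply/forallP.
have /leqif_sum [le <-] : forall i, true ->
    #|F1 i| <= #|F2 i| ?= iff (#|F1 i| == #|F2 i|) by move=> i _; split.
by rewrite eqn_leq le.
Qed.

(* The edge set [E] consists of the edges that some sequence of swaps frees. *)
Lemma maximal_packing_certificate F : maximal_packing F ->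
  exists E : {set {set G}}, [/\ E \subset edges G, unused F \subset E &
    forall i x y, connect (edge_rel E) x y -> connect (edge_rel (F i :&: E)) x y].
Proof.
case=> FP Fmax.
pose E := \bigcup_(F' | connect swap F F') unused F'.
have unE F' : connect swap F F' -> unused F' \subset E by move=> FF'; apply: bigcup_sup.
have EG : E \subset edges G by apply/bigcupsP => F' _; apply: subsetDl.
exists E; split=> //; first exact: unE.
(* By maximality a free edge cannot be added to a forest, so the forest joins its ends. Each edge
   [f] of the joining path can be swapped for the free edge, becomes free itself, and so lies in
   [E]. *)
have spanned F' a b i : connect swap F F' -> [set a; b] \in unused F' ->
    connect (edge_rel (F' i :&: E)) a b.
  move=> FF' abU; have [F'P F'sz] := swap_connect FF' FP.
  have [F'G F'a _] := packingP _ F'P; have [abG abF] := unusedP _ _ abU.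
  have ab : connect (edge_rel (F' i)) a b.
    apply/negPn/negP => nab.
    have P1 := packing_exchange F'P abU (subxx _) (acyclic_setU1 (F'a i) nab).
    have := Fmax _ P1; suff le j : #|F j| <= #|update F' i ([set a; b] |: F' i) j|.
      by move=> /(_ le i); rewrite ffunE eqxx cardsU1 abF F'sz; lia.
    by rewrite -F'sz ffunE; case: eqP => // ->; apply/subset_leq_card/subsetU1.
  have [D [DF Dab] Dcut] := acyclic_path (F'G i) (F'a i) ab.
  apply: connect_mono Dab; apply/subsetP => f fD; rewrite inE.
  have fF := subsetP DF _ fD; rewrite fF /=.
  have DfF := subD1set (F' i) f.
  have P1 : packing (update F' i ([set a; b] |: F' i :\ f)).
    apply: packing_exchange => //; apply: acyclic_setU1 (Dcut _ fD).
    exact: acyclic_sub (F'a i).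
  apply: (subsetP (unE (update F' i ([set a; b] |: F' i :\ f)) _)).
    apply: connect_trans FF' (connect1 _); rewrite /swap P1; apply/existsP; exists i.
    apply/existsP; exists [set a; b]; apply/existsP; exists f.
    by rewrite abU fF eqxx.
  apply/unusedP; split=> [|j]; first exact: subsetP (F'G i) _ fF.
  rewrite ffunE; case: (eqVneq j i) => [_|ji].
    by rewrite !inE eqxx orbF; apply: contraNneq (abF i) => <-.
  have [_ _ F'D] := packingP _ F'P; apply/negP => fj.
  by have /pred0P/(_ f) /= := F'D _ _ ji; rewrite fj fF.
(* Undo the swaps one by one: the only edge that a swap brings in was free just before, so [spanned]
   replaces it by a path in the earlier forest restricted to [E]. *)
have transfer F' i x y : connect swap F F' ->
    connect (edge_rel (F' i :&: E)) x y -> connect (edge_rel (F i :&: E)) x y.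
  case/connectP => p; elim/last_ind: p F' x y => [|p F2 IH] F' x y; first by move=> _ ->.
  rewrite rcons_path last_rcons => /andP[pP sw] ->; set F1 := last F p in sw.
  have FF1 : connect swap F F1 by apply/connectP; exists p.
  case/andP: sw => _ /existsP[j /existsP[e /existsP[f /and3P[eU fF /eqP def]]]] xy.
  apply: (IH F1) => //; move: xy; rewrite def ffunE.
  case: eqP => [->|//]; apply: connect_sub => u v uv.
  have /setIP[/setU1P[def_e|/setD1P[_ uvF]] uvE] := uv.
    by apply: spanned => //; rewrite def_e.
  by apply: connect_edge; rewrite inE uvF.
move=> i; apply: connect_sub => x y /bigcupP[F' FF' xyU].
exact: transfer FF' (spanned _ _ _ _ FF' xyU).
Qed.

End Packing.

(** * Cuts *)

Lemma leq_card_bigcup (I T : finType) (P : pred I) (A : I -> {set T}) :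
  #|\bigcup_(i | P i) A i| <= \sum_(i | P i) #|A i|.
Proof.
apply: (big_ind2 (fun (B : {set T}) n => #|B| <= n)) => // [|B m C n Bm Cn].
  by rewrite cards0.
exact: leq_trans (leq_card_setU B C) (leq_add Bm Cn).
Qed.

Section Cuts.
Variable G : sgraph.
Implicit Types (B C : {set G}) (E : {set {set G}}).

(** Ordered pairs are counted, so [between B B] is twice the number of edges inside [B]. *)
Definition between B C : nat := \sum_(x in B) \sum_(y in C) adj x y.

Definition cut B := between B (~: B).

Lemma betweenC B C : between B C = between C B.
Proof.
rewrite /between exchange_big; apply: eq_bigr => x _; apply: eq_bigr => y _.
by rewrite adj_sym.
Qed.

Lemma min_degree_leq (x : G) : min_degree G <= degree x.
Proof.
rewrite /min_degree; elim: (index_enum G) (mem_index_enum x) => // y s IH.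
rewrite big_cons inE => /orP[/eqP<-|/IH]; first exact: geq_minl.
exact/leq_trans/geq_minr.
Qed.

Lemma degree_sum (x : G) B :
  degree x = (\sum_(y in B) adj x y + \sum_(y in ~: B) adj x y).
Proof.
have -> : degree x = \sum_y adj x y.
  rewrite /degree -sum1_card big_mkcond; apply: eq_bigr => y _.
  by rewrite inE; case: adj.
by rewrite (bigID [in B]) /=; congr (_ + _); apply: eq_bigl => y; rewrite ?inE.
Qed.

Lemma min_degree_card B : min_degree G * #|B| <= between B B + cut B.
Proof.
rewrite mulnC -sum_nat_const /cut /between -big_split /=.
by apply: leq_sum => x _; rewrite -degree_sum min_degree_leq.
Qed.

(** With [s] vertices in [B] and minimum degree [d], each vertex has at most [s - 1] neighbours in
    [B], so the cut is at least [s * (d - s + 1)], which exceeds [d] by [(s - 1) * (d - s) >= 0]. *)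
Lemma cut_small B : B != set0 -> #|B| <= min_degree G -> min_degree G <= cut B.
Proof.
move=> /set0Pn[x0 x0B] Bsmall.
have BB : between B B <= #|B| * #|B|.-1.
  rewrite -sum_nat_const; apply: leq_sum => x xB.
  rewrite (big_setD1 x xB) /= adj_irrefl add0n.
  rewrite (cardsD1 x B) xB add1n /= -sum1_card; apply: leq_sum => y _.
  exact: leq_b1.
have := min_degree_card B.
have : 0 < #|B| by apply/card_gt0P; exists x0.
move: (cut B) (between B B) (min_degree G) #|B| BB Bsmall => c b d s; nia.
Qed.

(** * Components and the edges crossing them *)

Definition component E (r : G) : {set G} := [set x | connect (edge_rel E) r x].

Definition crossing E : {set {set G}} :=
  [set e in edges G | [exists x, exists y,
     (e == [set x; y]) && ~~ connect (edge_rel E) x y]].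

Lemma component_partition (E : {set {set G}}) (f : G -> nat) :
  \sum_(r | fingraph.roots (edge_rel E) r) \sum_(x in component E r) f x = \sum_x f x.
Proof.
have Esym := edge_connect_sym E.
rewrite [RHS](partition_big (fingraph.root (edge_rel E)) (fingraph.roots (edge_rel E))) /=;
  last by move=> x _; apply: roots_root.
apply: eq_bigr => r /eqP rr; apply: eq_bigl => x.
by rewrite inE -(root_connect Esym) rr eq_sym.
Qed.

(** The cuts together count the ordered pairs [Q] of adjacent vertices in different components; at
    most two such pairs have the same underlying edge. *)
Lemma sum_cut_crossing (E : {set {set G}}) :
  \sum_(r | fingraph.roots (edge_rel E) r) cut (component E r) <= 2 * #|crossing E|.
Proof.
pose Q := [set p : G * G | adj p.1 p.2 && ~~ connect (edge_rel E) p.1 p.2].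
have -> : \sum_(r | fingraph.roots (edge_rel E) r) cut (component E r) = #|Q|.
  transitivity (\sum_x \sum_(y | ~~ connect (edge_rel E) x y) adj x y).
    rewrite -(component_partition E); apply: eq_bigr => r _.
    apply: eq_bigr => x; rewrite inE => rx; apply: eq_bigl => y.
    by rewrite !inE (same_connect (edge_connect_sym E) rx).
  rewrite pair_big_dep /= -sum1_card big_mkcond [RHS]big_mkcond /=.
  by apply: eq_bigr => -[x y] _; rewrite !inE /=; case: adj; case: connect.
pose h (p : G * G) := [set p.1; p.2].
rewrite -sum1_card (partition_big h [in crossing E]) => [|[x y]]; last first.
  rewrite !inE /= => /andP[xy nxy]; apply/andP; split.
    by have := mem_edges x y; rewrite inE xy.
  by apply/existsP; exists x; apply/existsP; exists y; rewrite eqxx.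
rewrite mulnC -sum_nat_const; apply: leq_sum => e; rewrite inE => /andP[/edgesP[x [y [_ ->]]] _].
rewrite sum1_card; apply: (@leq_trans #|[set (x, y); (y, x)]|); last by rewrite cards2; case: eqP.
apply/subset_leq_card/subsetP => -[u v] /andP[_ /eqP/set2_eq /=].
by case=> [[-> ->]|[-> ->]]; rewrite !inE !eqxx ?orbT.
Qed.

(** As [F i :&: E] has the components of [E], exactly [ncomp E - ncomp (F i)] edges of [F i] lie
    outside [E]. A crossing edge is outside [E], hence used, hence among these. *)
Lemma crossing_bound (I : finType) (F : {ffun I -> {set {set G}}}) E :
  packing F -> E \subset edges G -> unused F \subset E ->
  (forall i x y, connect (edge_rel E) x y -> connect (edge_rel (F i :&: E)) x y) ->
  #|crossing E| + \sum_i ncomp (F i) <= #|I| * ncomp E.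
Proof.
case/packingP => FG aF FD EG UE conE.
have cI i : #|F i :\: E| + ncomp (F i) = ncomp E.
  have := acyclic_card_ncomp (FG i) (aF i).
  have IF := subsetIl (F i) E.
  have := acyclic_card_ncomp (subset_trans IF (FG i)) (acyclic_sub IF (aF i)).
  rewrite (@eq_ncomp _ (F i :&: E) E); last first.
    move=> x y; apply/idP/idP; last exact: conE.
    by apply: connect_mono; apply: subsetIr.
  by rewrite -(cardsID E (F i)); lia.
rewrite -sum_nat_const -(eq_bigr _ (fun i _ => cI i)) big_split /= leq_add2r.
apply: leq_trans (subset_leq_card _) (leq_card_bigcup _ _).
apply/subsetP => e; rewrite inE => /andP[eG /existsP[x /existsP[y /andP[/eqP def_e nxy]]]].
have eE : e \notin E by apply: contra nxy; rewrite def_e; apply: connect_edge.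
have : e \notin unused F by apply: contra eE => /(subsetP UE).
rewrite in_setD eG andbT negbK => /bigcupP[i _ eF].
by apply/bigcupP; exists i; rewrite // in_setD eE.
Qed.
End Cuts.

(** * Second largest eigenvalue of a symmetric matrix *)

Local Open Scope ring_scope.
Local Open Scope sesquilinear_scope.

Lemma char_poly_similar (K : fieldType) n (P D : 'M[K]_n) : P \in unitmx ->
  char_poly (invmx P *m D *m P) = char_poly D.
Proof.
move=> Pu; rewrite /char_poly.
have -> : char_poly_mx (invmx P *m D *m P) =
    map_mx polyC (invmx P) *m char_poly_mx D *m map_mx polyC P.
  rewrite /char_poly_mx mulmxBr mulmxBl !map_mxM; congr (_ - _).
  by rewrite scalar_mxC -mulmxA -map_mxM mulVmx // map_mx1 mulmx1.
rewrite !det_mulmx mulrAC mulrC -det_mulmx -map_mxM mulVmx //.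
by rewrite map_mx1 det1 mulr1.
Qed.

Local Notation toC := (real_complex _).

Section Eigenvalues.
Variable R : rcfType.

Lemma count_flatten_nseq (T : eqType) (m : T -> nat) (s : seq T) a : uniq s ->
  count_mem a (flatten [seq nseq (m x) x | x <- s]) = ((a \in s) * m a)%N.
Proof.
elim: s => // x s IH /= /andP[xs us]; rewrite count_cat IH // count_nseq inE /=.
case: eqVneq xs => [->|_ _]; rewrite ?eqxx /=; last by rewrite add0n.
by move=> /negPf->; rewrite addn0.
Qed.

Lemma eigenvalues_sorted n (A : 'M[R]_n) : sorted >=%R (eigenvalues A).
Proof.
rewrite /eigenvalues; pose m a := mup a (char_poly A).
have : sorted >%R (rev (rootsR (char_poly A))).
  by rewrite rev_sorted; apply: sorted_roots.
rewrite (sorted_pairwise (rev_trans lt_trans)) (sorted_pairwise (rev_trans le_trans)).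
elim: (rev _) => //= x s IH /andP[xs /IH s_s]; rewrite pairwise_cat s_s andbT.
apply/andP; split.
  apply/allrelP => y z /nseqP[-> _] /flattenP[_ /mapP[t ts ->] /nseqP[-> _]].
  exact/ltW/(allP xs).
rewrite -/(m x); elim: (m x) => //= k ->; rewrite andbT.
by apply/allP => y /nseqP[-> _]; apply: lexx.
Qed.

Lemma char_poly_eigenvalues n (A : 'M[R]_n) (s : seq R) :
  char_poly A = \prod_(a <- s) ('X - a%:P) -> perm_eq (eigenvalues A) s.
Proof.
move=> def_p; apply/allP => a _ /=; apply/eqP.
rewrite /eigenvalues count_flatten_nseq; last first.
  rewrite rev_uniq; apply: (sorted_uniq lt_trans (@ltxx _ _)); exact: sorted_roots.
have p0 : char_poly A != 0 by apply/monic_neq0/char_poly_monic.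
rewrite mem_rev -(roots_on_rootsR p0) /= def_p mu_prod_XsubC root_prod_XsubC.
rewrite -has_pred1 has_count; by case: (count_mem a s) => // m; rewrite mul1n.
Qed.

(** Over [R[i]] the matrix is Hermitian, so the spectral theorem applies with real diagonal entries;
    comparing characteristic polynomials identifies these with [eigenvalues A]. *)
Lemma symmetric_diagonalization n (A : 'M[R]_n) : A^T = A ->
  exists (P : 'M[R[i]]_n) (d : 'I_n -> R),
    [/\ P \is unitarymx, map_mx toC A = P ^t* *m diag_mx (\row_i toC (d i)) *m P
      & perm_eq (eigenvalues A) (codom d)].
Proof.
move=> Asym; set B := map_mx toC A.
have Bherm : B \is hermsymmx.
  apply: realsym_hermsym.
    apply/is_hermitianmxP/matrixP => i j.
    by rewrite expr0 scale1r !mxE /= -[in LHS]Asym mxE.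
  by apply/mxOverP => i j; rewrite mxE; apply/complex_realP; exists (A i j).
have /orthomx_spectralP := hermitian_normalmx Bherm.
have := hermitian_spectral_diag_real Bherm; set P := spectralmx B; set D := spectral_diag B.
move=> Dreal defB; pose d i := complex.Re (D 0 i).
have PU : P \is unitarymx by apply: spectral_unitarymx.
have defD : D = \row_i toC (d i).
  by apply/rowP => i; rewrite mxE; apply/esym/RRe_real/(mxOverP Dreal).
exists P, d; split=> //; first by rewrite -defD -invmx_unitary.
apply: char_poly_eigenvalues; apply: (map_poly_inj toC).
rewrite map_char_poly -/B {1}defB char_poly_similar ?spectral_unit //.
rewrite char_poly_trig ?diag_mx_is_trig // rmorph_prod /= big_image /=.
by apply: eq_bigr => i _; rewrite !mxE eqxx defD mxE mulr1n map_polyXsubC.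
Qed.


Lemma second_eigenvalue_bound n (A : 'M[R]_n) (d : 'I_n -> R) :
  perm_eq (eigenvalues A) (codom d) ->
  forall i j, i != j -> (d i <= (eigenvalues A)`_1) || (d j <= (eigenvalues A)`_1).
Proof.
move=> dA i j ij; set l := _`_1; apply/negPn/negP; rewrite negb_or -!ltNge => /andP[li lj].
have : (2 <= count (> l) (eigenvalues A))%N.
  rewrite (permP dA) count_map.
  apply: (@leq_trans #|[set i; j]|); first by rewrite cards2 ij.
  rewrite cardE -size_filter; apply: uniq_leq_size; first exact: enum_uniq.
  by move=> x; rewrite mem_enum mem_filter mem_enum !inE => /orP[]/eqP->; rewrite /= ?li ?lj.
move=> cnt {li lj}; move: cnt; have := eigenvalues_sorted A; rewrite {}/l.
(* A list with fewer than two entries cannot have two above the bound, whatever the default value of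
   [_1]. *)
case: (eigenvalues A) => [|x [|y s]] //=; first by case: (_ < _).
move=> /andP[_ ys]; rewrite ltxx add0n.
have -> : count (> y) s = 0%N.
  apply/eqP; rewrite -leqn0 leqNgt -has_count; apply/hasPn => z zs /=.
  rewrite -leNgt; exact: (allP (order_path_min (rev_trans le_trans) ys)).
by case: (_ < _).
Qed.

End Eigenvalues.

(* Some combination of [y] and [z] vanishes at [i0], where the form is the only
   one to be possibly positive; the form is thus nonpositive on it. *)
Lemma diagonal_form_disc (C : numClosedFieldType) (I : finType) (i0 : I)
    (e y z : I -> C) (a b c : C) :
  (forall i, i != i0 -> e i <= 0) ->
  a = \sum_i e i * (y i * (y i)^*) -> b = \sum_i e i * (y i * (z i)^*) ->
  b = \sum_i e i * (z i * (y i)^*) -> c = \sum_i e i * (z i * (z i)^*) ->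
  0 < a -> b \is Num.real -> c \is Num.real -> a * c <= b ^+ 2.
Proof.
move=> e0 defa defb defb' defc a0 breal creal.
have areal : a \is Num.real by apply: gtr0_real.
rewrite real_leNgt ?realX ?realM //; apply/negP => b2.
(* One linear equation in two unknowns: [(z i0, - y i0)] solves it, and if [z i0 = 0] a unit vector
   is taken. *)
have [al [be [al_be nz]]] : exists al be : C,
    al * y i0 + be * z i0 = 0 /\ ~ (be = 0 /\ al = 0).
  have [z0|z0] := eqVneq (z i0) 0.
    have [y0|y0] := eqVneq (y i0) 0.
      exists 1, 0; rewrite z0 y0 !mulr0 addr0; split=> // -[_ /eqP].
      by rewrite oner_eq0.
    exists 0, 1; rewrite z0 mulr0 mul0r addr0; split=> // -[/eqP].
    by rewrite oner_eq0.
  exists (z i0), (- y i0); split; first by ring.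
  by case=> _ /eqP; apply/negP.
set w := fun i => al * y i + be * z i.
have Q0 : \sum_i e i * (w i * (w i)^*) <= 0.
  apply: sumr_le0 => i _; have [->|ii0] := eqVneq i i0.
    by rewrite /w al_be mul0r mulr0.
  by apply: mulr_le0_ge0; [exact: e0 | exact: mul_conjC_ge0].
have defQ : \sum_i e i * (w i * (w i)^*) =
    al * al^* * a + al * be^* * b + be * al^* * b + be * be^* * c.
  rewrite {1}defb defb' defa defc !mulr_sumr -!big_split /=; apply: eq_bigr => i _.
  by rewrite /w !(rmorphD, rmorphM) /=; ring.
have conja : a^* = a by apply/CrealP.
have conjb : b^* = b by apply/CrealP.
(* Completing the square. The left side is nonpositive and both terms on the right are nonnegative,
   so both vanish: first [be = 0], then [al = 0]. *)
have : a * (\sum_i e i * (w i * (w i)^*)) =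
    (a * al + b * be) * (a * al + b * be)^* + (a * c - b ^+ 2) * (be * be^*).
  by rewrite defQ !(rmorphD, rmorphM) /= conja conjb; ring.
have d0 : 0 < a * c - b ^+ 2 by rewrite subr_gt0.
set s := _ * _^*; set t := (_ - _) * _ => eq_st.
have s0 : 0 <= s by apply: mul_conjC_ge0.
have t0 : 0 <= t by apply: mulr_ge0; [exact: ltW | exact: mul_conjC_ge0].
have /eqP : s + t = 0.
  by apply/le_anti; rewrite -{1}eq_st addr_ge0 // andbT mulr_ge0_le0 // ltW.
rewrite paddr_eq0 // => /andP[+ /eqP].
rewrite mul_conjC_eq0 => /eqP s_eq0 /eqP; rewrite mulf_eq0 gt_eqF //= mul_conjC_eq0 => /eqP be0.
apply: nz; split=> //; move: s_eq0; rewrite be0 mulr0 addr0 => /eqP.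
by rewrite mulf_eq0 gt_eqF //= => /eqP.
Qed.

Definition shifted_form (R : pzRingType) n (A : 'M[R]_n) (l : R) (x y : 'rV[R]_n) :=
  (x *m A *m y^T) 0 0 - l * (x *m y^T) 0 0.

(** A reverse Cauchy-Schwarz inequality: in an orthonormal eigenbasis the form of [A - lambda_2] is
    diagonal with at most one positive coefficient. *)
Lemma second_eigenvalue_disc (R : rcfType) n (A : 'M[R]_n) (u v : 'rV[R]_n) :
  A^T = A -> let h := shifted_form A (eigenvalues A)`_1 in
  0 < h u u -> h u u * h v v <= h u v ^+ 2.
Proof.
move=> Asym; have [P [d [PU defA dA]]] := symmetric_diagonalization Asym.
have dl := second_eigenvalue_bound dA.
move: (_`_1) dl => l dl /=; set h := shifted_form A l.
pose y (x : 'rV[R]_n) := map_mx toC x *m P ^t*.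
pose e i : R[i] := toC (d i - l).
have hE x x' : toC (h x x') = \sum_i e i * (y x 0 i * (y x' 0 i)^*).
  have conj_map : (map_mx toC x')^T = (map_mx toC x') ^t*.
    by apply/matrixP => i j; rewrite !mxE; apply/esym/conjc_real.
  have E1 : toC ((x *m A *m x'^T) 0 0) = (y x *m diag_mx (\row_i toC (d i)) *m (y x') ^t*) 0 0.
    rewrite /y trmx_mul map_mxM trmxCK -conj_map !mulmxA -[_ *m P ^t* *m _ *m P]mulmxA.
    rewrite -[_ *m (_ *m P)]mulmxA [_ *m (_ *m P)]mulmxA -defA.
    by rewrite map_trmx -!map_mxM [RHS]mxE.
  have E2 : toC ((x *m x'^T) 0 0) = (y x *m (y x') ^t*) 0 0.
    rewrite /y trmx_mul map_mxM trmxCK -conj_map mulmxA mulmxKtV //.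
    by rewrite map_trmx -map_mxM [RHS]mxE.
  rewrite /h /shifted_form rmorphB rmorphM /= E1 E2 mul_mx_diag !mxE mulr_sumr -sumrB.
  apply: eq_bigr => i _; rewrite !mxE /e rmorphB /=; ring.
have hC x x' : h x x' = h x' x.
  have tr (X : 'M[R]_n) : X^T = X -> (x *m X *m x'^T) 0 0 = (x' *m X *m x^T) 0 0.
    move=> sX; have -> : x *m X *m x'^T = (x' *m X *m x^T)^T.
      by rewrite !trmx_mul trmxK sX mulmxA.
    by rewrite mxE.
  by have := tr 1%:M (trmx1 _ _); rewrite /h /shifted_form (tr _ Asym) !mulmx1 => ->.
move=> hu0.
(* If no coefficient is positive, the form is nonpositive everywhere, against [0 < h u u]. *)
have [i0 e0] : exists i0, forall i, i != i0 -> e i <= 0.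
  have [i0|ni0] := pickP (fun i => l < d i).
    move=> li0; exists i0 => i ii0; rewrite /e lecR subr_le0.
    by case/orP: (dl _ _ ii0) => //; rewrite leNgt li0.
  have : toC (h u u) <= 0.
    rewrite hE; apply: sumr_le0 => i _; apply: mulr_le0_ge0.
      by rewrite lecR subr_le0 leNgt ni0.
    exact: mul_conjC_ge0.
  by rewrite lecR leNgt hu0.
rewrite -lecR rmorphM rmorphXn /=.
apply: (@diagonal_form_disc _ _ i0 e (y u 0) (y v 0)) => //.
- by rewrite hC hE.
- by rewrite ltcR.
- by apply/complex_realP; exists (h u v).
- by apply/complex_realP; exists (h v v).
Qed.

(** * Spectral lower bound on the number of crossing edges *)

Section SpectralCuts.
Variables (R : rcfType) (G : sgraph).
Implicit Types B C : {set G}.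

Let A := adjacency_mx R G.

Definition indicator B : 'rV[R]_#|G| := \row_j (enum_val j \in B)%:R.

Lemma sum_enum_val (F : G -> R) : \sum_(j < #|G|) F (enum_val j) = \sum_x F x.
Proof. by rewrite [RHS](reindex (@enum_val _ G)) //; apply/onW_bij/enum_val_bij. Qed.

Lemma indicator_adjacency B C :
  (indicator B *m A *m (indicator C)^T) 0 0 = (between B C)%:R.
Proof.
rewrite betweenC /between natr_sum [RHS]big_mkcond -sum_enum_val mxE.
apply: eq_bigr => j _; rewrite !mxE; case: ifP => _; last first.
  by rewrite mulr0.
rewrite mulr1 natr_sum [RHS]big_mkcond -sum_enum_val; apply: eq_bigr => i _.
by rewrite !mxE adj_sym; case: ifP => _; rewrite ?mul1r ?mul0r.
Qed.

Lemma indicator_dot B C : (indicator B *m (indicator C)^T) 0 0 = #|B :&: C|%:R.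
Proof.
rewrite -sum1_card natr_sum big_mkcond -sum_enum_val mxE.
by apply: eq_bigr => j _; rewrite !mxE -natrM mulnb inE; case: (_ && _).
Qed.

Let l := lambda2 R G.
Let gap : R := (min_degree G)%:R - l.

(** Apply the reverse inequality to the indicator vectors. Disjointness removes the [l] term from
    the mixed value; [min_degree_card] bounds the diagonal values from below. *)
Lemma between_lower B C : [disjoint B & C] ->
  0 < gap * #|B|%:R - (cut B)%:R -> 0 < gap * #|C|%:R - (cut C)%:R ->
  (gap * #|B|%:R - (cut B)%:R) * (gap * #|C|%:R - (cut C)%:R)
    <= (between B C)%:R ^+ 2.
Proof.
move=> BC B0 C0; have Asym : A^T = A.
  by apply/matrixP => i j; rewrite !mxE adj_sym.
have formE (D : {set G}) : gap * #|D|%:R - (cut D)%:R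
    <= shifted_form A l (indicator D) (indicator D).
  rewrite /shifted_form indicator_adjacency indicator_dot setIid.
  have := min_degree_card D; rewrite -(ler_nat R) natrD natrM /gap; lra.
have /= := @second_eigenvalue_disc R _ A (indicator B) (indicator C) Asym.
rewrite -/(lambda2 R G) -/l {4}/shifted_form indicator_adjacency indicator_dot.
move: BC; rewrite -setI_eq0 => /eqP->; rewrite cards0 mulr0 subr0 => disc.
apply: le_trans (disc _); last exact: lt_le_trans (formE B).
by apply: ler_pM => //; apply: ltW.
Qed.

(** Each part other than the one of least cut contributes [2 * kappa], counting its own cut plus its
    edges to the least-cut part [r0]; the latter edges are paid for by the cut of [r0]. *)
Lemma sum_cut_lower (E : {set {set G}}) (kappa : R) (x0 : G) :
  0 <= kappa -> 2 * kappa <= (min_degree G)%:R ->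
  l < (min_degree G)%:R - 2 * kappa / ((min_degree G)%:R + 1) ->
  2 * kappa * ((ncomp E)%:R - 1) <=
    (\sum_(r | fingraph.roots (edge_rel E) r) cut (component E r))%:R.
Proof.
set delta := min_degree G => k0 k_delta l_lt.
have d1 : 0 < delta%:R + 1 :> R by rewrite ltr_wpDl.
have gap_delta : 2 * kappa < gap * (delta%:R + 1).
  by rewrite -ltr_pdivrMr // /gap -/delta; lra.
have gap0 : 0 < gap by rewrite -(pmulr_lgt0 _ d1); apply: le_lt_trans gap_delta; lra.
have Esym := edge_connect_sym E.
pose f r := cut (component E r).
(* By [cut_small] such a component has at least [delta + 1] vertices, and [gap * (delta + 1)]
   exceeds [2 * kappa] by the spectral hypothesis. *)
have slack r : (f r)%:R < 2 * kappa ->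
    2 * kappa - (f r)%:R <= gap * #|component E r|%:R - (f r)%:R.
  move=> fr; have ne : component E r != set0.
    by apply/set0Pn; exists r; rewrite inE connect0.
  have : (delta < #|component E r|)%N.
    rewrite ltnNge; apply/negP => /(cut_small ne).
    by rewrite -/delta -(ler_nat R) => /(le_trans k_delta); rewrite leNgt fr.
  rewrite -(ler_nat R) -natr1 => le; rewrite lerD2r; apply: ltW.
  by apply: lt_le_trans gap_delta _; rewrite ler_pM2l.
have root0 : fingraph.roots (edge_rel E) (fingraph.root (edge_rel E) x0).
  exact: roots_root.
case: (@arg_minnP _ _ (fingraph.roots (edge_rel E)) f root0) => r0 r0r r0min.
have disj r : fingraph.roots (edge_rel E) r -> r != r0 ->
    [disjoint component E r0 & component E r].
  move=> rr rr0; rewrite -setI_eq0; apply/eqP/setP => x; rewrite !inE.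
  apply: contra_neqF rr0 => /andP[r0x rx].
  have : connect (edge_rel E) r r0 by apply: connect_trans rx _; rewrite Esym.
  by move=> /(fingraph.rootP Esym); rewrite (eqP rr) (eqP r0r).
(* If [f r < 2 * kappa], then [f r0 <= f r] makes both factors of [between_lower] at least
   [2 * kappa - f r], hence so is [b]. *)
have key r : fingraph.roots (edge_rel E) r -> r != r0 ->
    2 * kappa <= (f r + between (component E r0) (component E r))%:R.
  move=> rr rr0; rewrite natrD; set b := (between _ _)%:R.
  have b0 : 0 <= b by apply: ler0n.
  have [le|fr] := leP (2 * kappa) (f r)%:R; first lra.
  have le0 : (f r0)%:R <= (f r)%:R :> R by rewrite ler_nat r0min.
  have s0 := slack r0 (le_lt_trans le0 fr); have s := slack r fr.
  have := between_lower (disj r rr rr0); rewrite -/(f r0) -/(f r) -/b.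
  move: s0 s; move: (gap * _ - _) (gap * _ - _) => p q; nra.
have cut0 : (\sum_(r | fingraph.roots (edge_rel E) r && (r != r0))
    between (component E r0) (component E r) <= f r0)%N.
  rewrite /f /cut /between exchange_big /=; apply: leq_sum => x _.
  rewrite [leqRHS]big_mkcond -(component_partition E) [leqRHS](bigD1 r0) //=.
  apply: leq_trans (leq_addl _ _); apply: leq_sum => r /andP[rr rr0].
  apply: leq_sum => y yr; rewrite inE.
  by have /pred0P/(_ y) /= := disj r rr rr0; rewrite yr andbT => ->.
have -> : (\sum_(r | fingraph.roots (edge_rel E) r) f r)%N =
  (f r0 + \sum_(r | fingraph.roots (edge_rel E) r && (r != r0)) f r)%N by rewrite (bigD1 r0).
apply: (@le_trans _ _ (\sum_(r | fingraph.roots (edge_rel E) r && (r != r0))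
    (f r + between (component E r0) (component E r)))%:R); last first.
  by rewrite ler_nat big_split /= addnC leq_add2r.
rewrite natr_sum.
apply: (@le_trans _ _ (\sum_(r | fingraph.roots (edge_rel E) r && (r != r0)) (2 * kappa))).
  have -> : ncomp E = #|[pred r | fingraph.roots (edge_rel E) r && (r != r0)]|.+1.
    rewrite ncompE (cardD1 r0) [r0 \in _]r0r; congr _.+1.
    by apply: eq_card => r; rewrite !inE andbC.
  by rewrite -[X in X - 1]natr1 addrK sumr_const mulr_natr.
by apply: ler_sum => r /andP[]; apply: key.
Qed.

End SpectralCuts.

(** * Property P *)

Section Assembly.
Local Open Scope nat_scope.
Variable G : sgraph.
Implicit Types (E F : {set {set G}}) (x y : G).

Lemma ncomp_gt0 E x : 0 < ncomp E.
Proof.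
rewrite ncompE; apply/card_gt0P; exists (fingraph.root (edge_rel E) x).
exact/roots_root/edge_connect_sym.
Qed.

Lemma ncomp_connected E : ncomp E <= 1 -> forall x y, connect (edge_rel E) x y.
Proof.
have Esym := edge_connect_sym E.
rewrite ncompE => /card_le1_eqP le1 x y; apply/(fingraph.rootP Esym)/le1;
  exact: roots_root.
Qed.

Lemma card_component E r : fingraph.roots (edge_rel E) r ->
  #|component E r| + ncomp E <= #|G|.+1.
Proof.
move=> rr; rewrite -[#|G|]sum1_card -(component_partition E) (bigD1 r) //=.
rewrite sum1_card -addnS leq_add2l ncompE (cardD1 r) [r \in _]rr add1n ltnS.
rewrite -sum1_card [leqRHS](eq_bigl (fun x => x \in [predD1 fingraph.roots (edge_rel E) & r])).
  apply: leq_sum => x _; rewrite sum1_card; apply/card_gt0P; exists x.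
  by rewrite inE connect0.
by move=> x; rewrite !inE andbC.
Qed.

(** Every other component has at least one vertex, so under this hypothesis none exceeds
    [min_degree G] vertices and [cut_small] applies to each. *)
Lemma crossing_small E : #|G| < ncomp E + min_degree G ->
  min_degree G * ncomp E <= 2 * #|crossing E|.
Proof.
move=> nt; apply: leq_trans (sum_cut_crossing E).
rewrite ncompE mulnC -sum_nat_const; apply: leq_sum => r rr; apply: cut_small.
  by apply/set0Pn; exists r; rewrite inE connect0.
by have := card_component rr; lia.
Qed.

Lemma card_component_edges F d : F \subset edges G ->
  (forall x, #|component_edges F x| <= d) -> #|F| <= d * ncomp F.
Proof.
move=> FG Fd; have Fsym := edge_connect_sym F.
apply: (@leq_trans #|\bigcup_(r | fingraph.roots (edge_rel F) r) component_edges F r|).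
  apply/subset_leq_card/subsetP => e eF; case/edgesP: (subsetP FG _ eF) => x [y [_ def_e]].
  have xy : connect (edge_rel F) x y by apply: connect_edge; rewrite -def_e.
  have rx : connect (edge_rel F) (fingraph.root (edge_rel F) x) x.
    by rewrite Fsym connect_root.
  apply/bigcupP; exists (fingraph.root (edge_rel F) x); first exact: roots_root.
  rewrite inE eF def_e subUset !sub1set !inE rx; exact: connect_trans rx xy.
apply: leq_trans (leq_card_bigcup _ _) _.
by rewrite ncompE mulnC -sum_nat_const; apply: leq_sum.
Qed.

Lemma min_degree_lt_card x : min_degree G < #|G|.
Proof.
apply: leq_ltn_trans (min_degree_leq x) _; apply: proper_card.
apply/properP; split; first exact: subset_predT.
by exists x; rewrite ?inE ?adj_irrefl.
Qed.

(* The lower bound on [crossing E] is [(k + (d - 1) / d) (ncomp E - 1)], with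
   denominators cleared. *)
Lemma propertyP_crossing (k d : nat) : min_degree G = d -> 2 * k + 2 <= d ->
  (forall E, (k * d + d.-1) * (ncomp E).-1 <= d * #|crossing E|) ->
  propertyP G k d.
Proof.
move=> degG kd cross.
(* Without vertices the minimum degree would be its default value 0, but [d >= 2]. *)
have [x0 _] : exists x0 : G, true.
  have [x0 _|G0] := pickP (fun x : G => true); first by exists x0.
  by move: kd; rewrite -degG /min_degree big_pred0 // (eq_card0 G0); lia.
have dn := min_degree_lt_card x0; rewrite degG in dn.
have P0 : packing [ffun _ : 'I_k => set0 : {set {set G}}].
  apply/packingP; split=> [i|i|i j _]; rewrite !ffunE ?sub0set ?acyclic0 //.
  by rewrite disjoints_subset sub0set.
have [T0 T0max _] := maximal_packing_exists P0.
have [T0P _] := T0max; have [T0G T0a T0D] := packingP _ T0P.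
have [E0 [E0G UE0 conE0]] := maximal_packing_certificate T0max.
(* With [t] components of [E0], the upper bound gives at most [k * (t - 1)] crossing edges and
   [cross] then [(d - 1) * (t - 1) <= 0], so [t = 1]. *)
have T0conn i x y : connect (edge_rel (T0 i)) x y.
  apply: connect_mono (subsetIl _ E0) _ _ _; apply: (conE0); apply: ncomp_connected.
  have := crossing_bound T0P E0G UE0 conE0; rewrite card_ord.
  have : \sum_(i < k) 1 <= \sum_(i < k) ncomp (T0 i).
    by apply: leq_sum => j _; apply: ncomp_gt0 x0.
  rewrite sum_nat_const card_ord; have := cross E0; have := ncomp_gt0 E0 x0.
  move: (ncomp E0) #|_| (\sum_(_ < _) _) => t m s; nia.
have T0comp i : ncomp (T0 i) = 1.
  apply/eqP; rewrite eqn_leq (ncomp_gt0 _ x0) andbT ncompE.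
  apply/card_le1_eqP => x y rx ry.
  have /(fingraph.rootP (edge_connect_sym _)) := T0conn i x y.
  by rewrite (eqP rx) (eqP ry).
(* The index [None] holds the extra forest, initially empty; maximizing again cannot shrink the [k]
   trees. *)
pose F0 : {ffun option 'I_k -> {set {set G}}} :=
  [ffun o => if o is Some i then T0 i else set0].
have F0P : packing F0.
  apply/packingP; split=> [[i|]|[i|]|[i|] [j|]]; rewrite !ffunE ?sub0set ?acyclic0 //.
  - by move=> ij; apply: T0D; apply: contraNneq ij => ->.
  - by rewrite disjoint_sym disjoints_subset sub0set.
  - by rewrite disjoints_subset sub0set.
have [F Fmax F0F] := maximal_packing_exists F0P.
have [FP _] := Fmax; have [FG Fa FD] := packingP _ FP.
have [E [EG UE conE]] := maximal_packing_certificate Fmax.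
have Fconn i x y : connect (edge_rel (F (Some i))) x y.
  apply: ncomp_connected; have := F0F (Some i); rewrite ffunE.
  have := acyclic_card_ncomp (T0G i) (T0a i); rewrite T0comp.
  have := acyclic_card_ncomp (FG (Some i)) (Fa (Some i)); lia.
have bound : #|crossing E| + ncomp (F None) + k <= k.+1 * ncomp E.
  have := crossing_bound FP EG UE conE; rewrite card_option card_ord (bigD1 None) //=.
  have : \sum_(o : option 'I_k | o != None) 1 <= \sum_(o : option 'I_k | o != None) ncomp (F o).
    by apply: leq_sum => o _; apply: ncomp_gt0 x0.
  rewrite sum1_card cardC1 card_option card_ord /=.
  by move: (\sum_(_ | _) _) => s; lia.
exists (fun i => F (Some i)), (F None).
have FF o : is_forest (F o) by apply: acyclic_is_forest.
have Fn := acyclic_card_ncomp (FG None) (Fa None).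
have t0 := ncomp_gt0 E x0; have c0 := ncomp_gt0 (F None) x0.
have F_tree : ncomp E <= 1 -> is_spanning_tree (F None).
  move=> E1; split=> // x y; apply: connect_mono (subsetIl _ E) _ _ _; apply: (conE).
  exact: ncomp_connected.
(* Otherwise, with [t = ncomp E], [c = ncomp (F None)] and [m] crossing edges, [d * t <= 2 * m <= (2
   * k + 2) * t - 2 * c - 2 * k < d * t]. *)
have nt : 1 < ncomp E -> ncomp E + d <= #|G|.
  move=> t2; rewrite leqNgt; apply/negP; rewrite -degG => /crossing_small.
  rewrite degG; move: bound t0 c0.
  move: (ncomp E) (ncomp (F None)) #|crossing E| => t c m; nia.
(* Multiply [bound] by [d] and subtract [cross]: [d * c <= d * t - (d - 1) * (t - 1) = t + d -
   1]. *)
have dc : d * ncomp (F None) <= ncomp E + d.-1.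
  have := cross E; have := leq_mul (leqnn d) bound; move: t0 c0 kd.
  case: (ncomp E) => // t; case: (d) => [|d']; first by lia.
  by move: (ncomp (F None)) #|crossing E| => c m /= _ _ _; nia.
split=> //.
- split=> // i j ij; apply: FD; by apply: contraNneq ij => -[->].
- split=> // i; exact: FD.
- rewrite mulrAC ltr_pdivrMr; last by rewrite ltr0n; lia.
  (* If [E] is connected, [F None] has [#|G| - 1] edges. Otherwise it has [#|G| - c] edges, and [dc]
     reduces the claim to [ncomp E < #|G|]. *)
  have : d.-1 * #|G|.-1 < #|F None| * d.
    have [E1|E2] := leqP (ncomp E) 1.
      have c1 : ncomp (F None) = 1.
        by move: bound t0 c0 E1; move: #|_| (ncomp E) (ncomp _) => m t c; nia.
      move: Fn dn kd; rewrite c1; move: #|F None| #|G| => f n; nia.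
    move: (nt E2) Fn dn kd dc; move: #|F None| #|G| (ncomp _) (ncomp E) => f n c t; nia.
  rewrite -(ltr_nat rat) !natrM -!subn1 !natrB //; lia.
move=> Ntree; have E2 : 1 < ncomp E by rewrite ltnNge; apply/negP => /F_tree.
have [/existsP //|/existsPn small] := boolP [exists x, d <= #|component_edges (F None) x|].
(* With at most [d - 1] edges per component, [#|G| = #|F None| + c <= d * c <= ncomp E + d - 1],
   against [nt]. *)
have : #|F None| <= d.-1 * ncomp (F None).
  apply: card_component_edges => // x; have := small x; lia.
move: (nt E2) Fn dn kd dc; move: #|F None| #|G| (ncomp _) (ncomp E) => f n c t; nia.
Qed.

End Assembly.

Theorem theorem1p6 (R : rcfType) (k : nat) (hk : (0 < k)%N)
  (G : sgraph) (delta : nat) (hdelta : min_degree G = delta)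
  (hdeltak : (2 * k + 2 <= delta)%N)
  (hlambda : lambda2 R G <
     delta%:R - 2%:R * (k%:R + (delta%:R - 1) / delta%:R) / (delta%:R + 1)) :
  propertyP G k delta.
Proof.
apply: propertyP_crossing => // E.
have [x0 _|G0] := pickP (fun x : G => true); last first.
  by move: hdeltak; rewrite -hdelta /min_degree big_pred0 // (eq_card0 G0); lia.
set kappa := k%:R + _ in hlambda.
have d0 : 0 < delta%:R :> R by rewrite ltr0n; lia.
have kappaE : kappa * delta%:R = (k * delta + delta.-1)%:R.
  rewrite natrD natrM -subn1 natrB; last lia.
  by rewrite mulrDl divfK // gt_eqF.
have kappa0 : 0 <= kappa by rewrite -(pmulr_lge0 _ d0) kappaE ler0n.
(* After multiplication by [delta] this reads [2 * (k * delta + delta - 1) <= delta ^ 2], which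
   follows from [2 * k + 2 <= delta]. *)
have kappa_delta : 2 * kappa <= (min_degree G)%:R.
  rewrite hdelta -(ler_pM2r d0) -mulrA kappaE -!natrM ler_nat; nia.
have := sum_cut_lower E x0 kappa0 kappa_delta; rewrite hdelta => /(_ hlambda).
have := sum_cut_crossing E; rewrite -(ler_nat R) natrM => le1 le2.
have {le1 le2} : kappa * ((ncomp E)%:R - 1) <= #|crossing E|%:R.
  move: (le_trans le2 le1); lra.
rewrite -(ler_pM2l d0) mulrA [_ * kappa]mulrC kappaE -(ler_nat R) !natrM.
by rewrite -[(ncomp E).-1]subn1 natrB // (ncomp_gt0 E x0).
Qed.
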